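(* Let $p$ be a prime, let $G$ be a nonabelian $p$-group, and let $\pi$ be a faithful, irreducible representation of $G$. Let $(G_0,r,\tau)$ be a split K-triple for $\pi$. Then \[ p_0(\pi) \le p_0(\tau) + \frac{p^r-1}{p^{2r}}. \]
   Context: A $p$-group is a finite group of order $p^s$ with $s>0$, $p$ prime. All representations are unitary. For a unitary representation $\pi$ of a finite group $G$ on $\mathcal{H}_\pi$ and $\eta,f\in\mathcal{H}_\pi$ put $V_\eta f(x) = \langle f,\pi(x)\eta\rangle$, $x \in G$. Define \[ p_0(\pi,\eta) = \max_{f\in\mathcal{H}_\pi\setminus\{0\}}\left(1-\frac{|\mathrm{supp}(V_\eta f)|}{|G|}\right),\qquad p_0(\pi) = \min\{p_0(\pi,\eta) : \eta\in\mathcal{H}_\pi\setminus\{0\}\}, \] where $\mathrm{supp}(V_\eta f)=\{x \in G: V_\eta f(x)\neq 0\}$. The same definition is used for the representation $\tau$ of the group $G_0$. Notation: $[w,y] = w^{-1}y^{-1}wy$; $Z(G)$ is the center of $G$; $Z_1(G) = \{y \in G : yZ(G) \in Z(G/Z(G))\}$; $[G,y] = \{[w,y] : w\in G\}$; $\mathbb{Z}_n = \mathbb{Z}/n\mathbb{Z}$. K-triple: Let $G$ be a $p$-group and $\pi$ an irreducible, faithful representation of $G$. A triple $(G_0,r,\tau)$ is a K-triple for $\pi$ if $r\in\mathbb{N}$, $G_0 \lhd G$, $\tau$ is a representation of $G_0$ with $\pi \simeq \mathrm{ind}_{G_0}^G\tau$, and there exist $x\in G$, $y \in Z_1(G)\setminus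 Z(G)$, $z \in Z(G)$ such that (i) $[x,y]=z$ and $\langle z\rangle = [G,y]\cong \mathbb{Z}_{p^r}$; (ii) $G_0$ is the centralizer of $y$ in $G$; (iii) $G/G_0 = \langle xG_0\rangle \cong \mathbb{Z}_{p^r}$. The K-triple is split if $x$ can be chosen such that $x^{p^r} = e$. *)

(* Defs.v *)
From HB Require Import structures.
From mathcomp Require Import all_boot all_order all_algebra all_fingroup.
From mathcomp Require Import all_solvable mxrepresentation spectral complex.
From mathcomp Require Import boolp classical_sets reals.

Set Implicit Arguments.
Unset Strict Implicit.
Unset Printing Implicit Defensive.

Import Order.TTheory GRing.Theory Num.Theory.
Local Open Scope ring_scope.

(* The complex numbers are R[i] for R : realType. A representation on C^n is   *)
(* an mx_representation acting on column vectors: x sends v to rG x *m v, so   *)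
(* that x |-> rG x is a homomorphism into left operators. The library's        *)
(* mx_irreducible is stated with row spaces; taking annihilators, it says the  *)
(* same about invariant subspaces of columns.                                  *)

Definition inner (R : realType) (n : nat) (u v : 'cV[R[i]]_n) : R[i] :=
  \sum_(i < n) u i 0 * Num.conj (v i 0).

Definition unitary_repr (R : realType) (gT : finGroupType) (G : {group gT})
    (n : nat) (rG : mx_representation R[i] G n) : Prop :=
  forall x, x \in G -> rG x \is unitarymx.

Section ZeroProportion.

Variables (R : realType) (gT : finGroupType) (G : {group gT}) (n : nat).
Variable rG : mx_representation R[i] G n.

Definition voice (eta f : 'cV[R[i]]_n) (x : gT) : R[i] :=
  inner f (rG x *m eta).

Definition voice_supp (eta f : 'cV[R[i]]_n) : {set gT} :=
  [set x in G | voice eta f x != 0].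

(* The sup and inf below are a max and a min whenever n > 0: see p0_at_max     *)
(* and p0_min.                                                                 *)
Definition p0_at (eta : 'cV[R[i]]_n) : R :=
  sup [set 1 - #|voice_supp eta f|%:R / #|G|%:R
      | f in [set f : 'cV[R[i]]_n | f != 0]]%classic.

Definition p0 : R :=
  inf [set p0_at eta | eta in [set eta : 'cV[R[i]]_n | eta != 0]]%classic.

End ZeroProportion.

Lemma finite_valued_max (R : realType) (N : nat) (g : nat -> R) (S : set R) :
    (S !=set0)%classic -> (forall s, S s -> exists2 k, (k <= N)%N & s = g k) ->
  S (sup S) /\ (forall s, S s -> s <= sup S).
Proof.
move=> [s0 Ss0] Sfin.
have [k0 k0N s0E] := Sfin _ Ss0.
pose P (k : 'I_N.+1) := `[< S (g k) >].
have Pk0 : P (Ordinal (k0N : (k0 < N.+1)%N)) by apply/asboolP; rewrite /= -s0E.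
case: (@Order.TotalTheory.arg_maxP _ _ _ _ P (fun k => g k) Pk0)
  => k /asboolP Sk kmax.
have ub_k : ubound S (g k).
  move=> s Ss; have [j jN sE] := Sfin _ Ss.
  rewrite sE; apply: (kmax (Ordinal (jN : (j < N.+1)%N))).
  by apply/asboolP; rewrite /= -sE.
have supE : sup S = g k.
  apply/eqP; rewrite eq_le; apply/andP; split.
    by apply: ge_sup => //; exists s0.
  by apply: ub_le_sup => //; exists (g k).
by rewrite supE; split.
Qed.

Section ZeroProportionAttained.

Variables (R : realType) (gT : finGroupType) (G : {group gT}) (n : nat).
Variable rG : mx_representation R[i] G n.
Hypothesis n_gt0 : (0 < n)%N.

Let cV_neq0 : exists v : 'cV[R[i]]_n, v != 0.
Proof.
exists (const_mx 1); apply/eqP => /matrixP/(_ (Ordinal n_gt0) 0).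
by rewrite !mxE => /eqP; rewrite oner_eq0.
Qed.

Lemma p0_at_max (eta : 'cV[R[i]]_n) :
  (exists2 f, f != 0 & p0_at rG eta = 1 - #|voice_supp rG eta f|%:R / #|G|%:R)
  /\ forall f, f != 0 -> 1 - #|voice_supp rG eta f|%:R / #|G|%:R <= p0_at rG eta.
Proof.
rewrite /p0_at; set S := (X in sup X).
have [||Ssup Sub] := @finite_valued_max R #|gT| (fun k => 1 - k%:R / #|G|%:R) S.
- by have [v v0] := cV_neq0; eexists; exists v.
- by move=> _ [f _ <-]; exists #|voice_supp rG eta f| => //; exact: max_card.
split; first by case: Ssup => f f0 fE; exists f.
by move=> f f0; apply: Sub; exists f.
Qed.

Lemma p0_min :
  (exists2 eta, eta != 0 & p0 rG = p0_at rG eta)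
  /\ forall eta, eta != 0 -> p0 rG <= p0_at rG eta.
Proof.
rewrite /p0 /inf; set S := (X in sup X).
have [||Ssup Sub] :=
  @finite_valued_max R #|gT| (fun k => - (1 - k%:R / #|G|%:R)) S.
- by have [v v0] := cV_neq0; exists (- p0_at rG v), (p0_at rG v) => //; exists v.
- move=> _ [_ [eta _ <-] <-]; have [[f _ ->] _] := p0_at_max eta.
  by exists #|voice_supp rG eta f| => //; exact: max_card.
split.
  by case: Ssup => _ [eta eta0 <-] <-; exists eta => //; rewrite opprK.
move=> eta eta0; rewrite lerNl; apply: Sub.
by exists (p0_at rG eta) => //; exists eta.
Qed.

End ZeroProportionAttained.

Section Induction.

Variables (R : realType) (gT : finGroupType) (G H : {group gT}) (n d : nat).
Variable rG : mx_representation R[i] G n.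
Variable rH : mx_representation R[i] H d.

(* Functions on G are encoded as functions on gT vanishing off G.              *)
Definition ind_space (F : {ffun gT -> 'cV[R[i]]_d}) : Prop :=
  (forall g, g \notin G -> F g = 0) /\
  (forall g h, g \in G -> h \in H -> F (g * h)%g = rH h^-1%g *m F g).

Definition ind_inner (F1 F2 : {ffun gT -> 'cV[R[i]]_d}) : R[i] :=
  #|H|%:R^-1 * \sum_(g in G) inner (F1 g) (F2 g).

Definition ind_act (x : gT) (F : {ffun gT -> 'cV[R[i]]_d}) :
    {ffun gT -> 'cV[R[i]]_d} :=
  [ffun g => F (x^-1 * g)%g].

(* Unitary equivalence of rG with the representation induced from rH.          *)
Definition equiv_ind : Prop :=
  exists T : {linear 'cV[R[i]]_n -> {ffun gT -> 'cV[R[i]]_d}},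
    [/\ forall F, ind_space F <-> exists v, T v = F,
        forall u v, ind_inner (T u) (T v) = inner u v
      & forall x v, x \in G -> T (rG x *m v) = ind_act x (T v)].

End Induction.

Section KTriple.

Variables (gT : finGroupType) (G : {group gT}).

Definition Z1 : {set gT} :=
  [set y in G | coset 'Z(G) y \in 'Z(G / 'Z(G))%g].

Definition commutators_with (y : gT) : {set gT} :=
  [set [~ w, y]%g | w in G].

(* Zp m, unlike the ring 'Z_m, is cyclic of order m also for m = 1.            *)
Definition K_elements (p : nat) (G0 : {group gT}) (r : nat) (x y z : gT) :
    Prop :=
  [/\ [/\ x \in G, y \in Z1 :\: 'Z(G)%g & z \in 'Z(G)%g],
      [/\ [~ x, y]%g = z, <[z]>%g = commutators_with y
        & commutators_with y \isog Zp (p ^ r)],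
      G0 = 'C_G[y]%g :> {set gT}
    & (G / G0)%g = <[coset G0 x]>%g /\ (G / G0)%g \isog Zp (p ^ r)].

Variables (R : realType) (n : nat) (rG : mx_representation R[i] G n).

Definition K_triple_with (Px : gT -> Prop) (p : nat) (G0 : {group gT})
    (r d : nat) (tau : mx_representation R[i] G0 d) : Prop :=
  [/\ (G0 <| G)%g, unitary_repr tau, equiv_ind rG tau
    & exists x y z, K_elements p G0 r x y z /\ Px x].

Definition K_triple (p : nat) (G0 : {group gT}) (r d : nat)
    (tau : mx_representation R[i] G0 d) : Prop :=
  K_triple_with (fun=> True) p r tau.

Definition split_K_triple (p : nat) (G0 : {group gT}) (r d : nat)
    (tau : mx_representation R[i] G0 d) : Prop :=
  K_triple_with (fun x => x ^+ (p ^ r) = 1)%g p r tau.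

End KTriple.

(* Main.v *)
Require Import Defs.
From HB Require Import structures.
From mathcomp Require Import all_boot all_order all_algebra all_fingroup.
From mathcomp Require Import all_solvable mxrepresentation spectral complex.
From mathcomp Require Import boolp classical_sets reals.
From mathcomp Require Import zify ring.

Set Implicit Arguments.
Unset Strict Implicit.
Unset Printing Implicit Defensive.

Import Order.TTheory GRing.Theory Num.Theory.
Local Open Scope ring_scope.

(* Let q = p^r. The representation pi acts on tuples (F(x^j)) indexed by      *)
(* j in Z/q, where x shifts the index and y acts on the j-th entry by a       *)
(* scalar multiple of w^j, for a primitive q-th root of unity w. Let eta0 be  *)
(* optimal for tau and let eta have entries a_j eta0. For fixed h in G0, the  *)
(* q^2 values V_eta f (h y^m x^k) are, up to nonzero factors, the short-time  *)
(* Fourier transform with window a of the vector b_j = <F(x^j), tau(h^(x^j))  *)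
(* eta0>. For a suitable window every nonzero b has at most q - 1 zeros in    *)
(* its transform (Malikiosis), while b = 0 for at most a proportion p0(tau)   *)
(* of the h; this gives the bound.                                            *)
(* The window is a_e = t^(e^2 + q e) for a generic t. Each q x q minor of the *)
(* Gabor system is then a polynomial in t; after a cyclic rotation of Z/q and *)
(* a rescaling of rows and columns by powers of t, its value at t = 0 is the  *)
(* determinant of a block matrix with Vandermonde blocks.                     *)

(** * Full spark of the Gabor system of a chirp window *)

(** The bound comes from counting zeros twice. Write q = p^r. Since h |-> h y^m permutes G0, q times
    the number of zeros of [voice pi eta f] is the sum over h in G0 of the number of pairs (k, m)
    giving a zero at h y^m x^k. For fixed h these are the zeros of a Gabor transform on Z/q of a
    vector b_h ([voice_zeros_gabor]): x^q = 1 makes the translations cyclic, the scalars tau(y) and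
    tau(z) give the modulations, and faithfulness makes their frequency primitive. If b_h is nonzero
    there are at most q - 1 zeros ([gabor_full_spark]); otherwise there are at most q^2. Each h with
    b_h = 0 is counted by a zero of one voice transform of tau at its optimal vector, so the
    proportion of such h is at most p0(tau). Dividing by q^2 |G0| gives the bound
    ([sum_voice_zeros]). The spark property is a lowest-order-term argument. In a minor whose sorted
    translations satisfy k i <= i, suitable weights on rows and columns make all exponents of t
    nonnegative, and zero exactly where k i = k j ([chirp_lower], [chirp_tight]); the constant term
    is then [block_vandermonde_det_neq0]. The cycle lemma [sorted_rotation] reduces every minor to
    this case. *)

Section Potential.
Variables (q : nat) (k : nat -> nat).
Hypothesis k_mono : forall i j, (i <= j < q)%N -> (k i <= k j)%N.
Hypothesis k_le : forall i, (i < q)%N -> (k i <= i)%N.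

(* Chosen so that j |-> potential j - 2 * j * k i, whose increments are        *)
(* k j + k j.+1 - 2 * k i, is minimal exactly on the block k j = k i.         *)
Definition potential j := (\sum_(l < j) (k l + k l.+1))%N.

Lemma potentialS j : potential j.+1 = (potential j + (k j + k j.+1))%N.
Proof. by rewrite /potential big_ord_recr. Qed.

Lemma potential_up i d : (i + d < q)%N ->
  (potential i + 2 * d * k i + (k (i + d) - k i) <= potential (i + d))%N.
Proof.
elim: d => [|d IHd] lt_q; first by rewrite !addn0; lia.
have {}IHd := IHd ltac:(lia).
have h1 := @k_mono i (i + d) ltac:(lia).
have h2 := @k_mono (i + d) (i + d).+1 ltac:(lia).
rewrite addnS potentialS; nia.
Qed.

Lemma potential_down j d : (j + d < q)%N ->
  (potential (j + d) + (k (j + d) - k j) <= potential j + 2 * d * k (j + d))%N.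
Proof.
elim: d => [|d IHd] lt_q; first by rewrite !addn0; lia.
have {}IHd := IHd ltac:(lia).
have h1 := @k_mono j (j + d) ltac:(lia).
have h2 := @k_mono (j + d) (j + d).+1 ltac:(lia).
rewrite addnS potentialS; nia.
Qed.

(** Discrete convexity: 2 * k i is a subgradient of [potential] at i, and the inequality gains at
    least 1 off the block of i. *)
Lemma potential_convex i j : (i < q)%N -> (j < q)%N ->
  (potential i + 2 * j * k i + (k i != k j) <= potential j + 2 * i * k i)%N.
Proof.
move=> iq jq; case: (leqP i j) => ij.
  have := @potential_up i (j - i); rewrite subnKC // => /(_ jq).
  by have := @k_mono i j ltac:(lia); case: eqP; nia.
have := @potential_down j (i - j); rewrite (subnKC (ltnW ij)) => /(_ iq).
by have := @k_mono j i ltac:(lia); case: eqP; nia.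
Qed.

Lemma potential_eq i j : (i < q)%N -> (j < q)%N -> k i = k j ->
  (potential i + 2 * j * k i = potential j + 2 * i * k i)%N.
Proof.
move=> iq jq eq_k; have := potential_convex iq jq.
have := potential_convex jq iq; rewrite eq_k; lia.
Qed.

(** The linear term handles cyclic wraparound: replacing e - q by e raises the quadratic expression
    by 2 q e, which is positive for e > 0. With e^2 alone the change 2 q e - q^2 could be
    negative. *)
Definition chirp e := (e * e + q * e)%N.
Definition row_weight i := (q * k i + 2 * i * k i)%N.
Definition row_offset i := (potential i + k i * k i)%N.
Definition col_weight j := (j * j + q * j)%N.

Lemma modn_wrap j a : (j < q)%N -> (a <= j)%N -> ((j + q - a) %% q = j - a)%N.
Proof.
by move=> jq aj; rewrite (_ : j + q - a = j - a + q)%N ?modnDr ?modn_small; lia.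
Qed.

(** Without wraparound the squares cancel and the gap between the two sides is that of
    [potential_convex]; wraparound only adds to it. *)
Lemma chirp_lower i j : (i < q)%N -> (j < q)%N ->
  (row_offset i + col_weight j + (k i != k j)
    <= chirp ((j + q - k i) %% q) + row_weight i + potential j)%N.
Proof.
move=> iq jq; have hc := potential_convex iq jq.
have ki := k_le iq; have kj := k_le jq.
rewrite /row_offset /col_weight /chirp /row_weight.
case: (leqP (k i) j) => kij.
  rewrite modn_wrap //; move: (subnKC kij); move: (j - k i)%N => e je.
  by move: hc; case: eqP; nia.
rewrite modn_small; last by lia.
have [e je] : exists e, (j + q = k i + e)%N by exists (j + q - k i)%N; lia.
rewrite (_ : j + q - k i = e)%N; last by lia.
by move: hc; case: eqP; nia.
Qed.

Lemma chirp_tight i j : (i < q)%N -> (j < q)%N -> k i = k j ->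
  (row_offset i + col_weight j
    = chirp ((j + q - k i) %% q) + row_weight i + potential j)%N.
Proof.
move=> iq jq eq_k; have hc := potential_eq iq jq eq_k.
have kij : (k i <= j)%N by rewrite eq_k k_le.
rewrite /row_offset /col_weight /chirp /row_weight modn_wrap //.
move: (subnKC kij); move: (j - k i)%N => e je; nia.
Qed.

End Potential.

(** * Nonvanishing of the minors as polynomials in t *)

Section Minor.
Variables (F : fieldType) (q' : nat).
Local Notation q := q'.+1.
Variables (w : F) (k m : nat -> nat).
Hypothesis w_prim : q.-primitive_root w.
Hypothesis k_mono : forall i j, (i <= j < q)%N -> (k i <= k j)%N.
Hypothesis k_le : forall i, (i < q)%N -> (k i <= i)%N.
Hypothesis m_lt : forall i, (i < q)%N -> (m i < q)%N.
Hypothesis km_inj : forall i j, (i < q)%N -> (j < q)%N ->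
  k i = k j -> m i = m j -> i = j.

(** As k is monotone, the blocks are intervals of indices. On the block from s to e, a kernel vector
    gives a polynomial with e - s + 1 coefficients that vanishes at the distinct nodes w^(m i), once
    the factor w^(m i * s) is removed. *)
Lemma block_vandermonde_det_neq0 :
  \det (\matrix_(i < q, j < q) (w ^+ (m i * j) *+ (k i == k j))) != 0.
Proof.
rewrite -det_tr; apply/det0P => -[v v_neq0 vM].
case/rV0Pn: v_neq0 => j0; apply/negP; rewrite negbK.
pose B := [pred i : 'I_q | k i == k j0].
have Bj0 : B j0 by rewrite /= eqxx.
case: (arg_minnP (fun i : 'I_q => i : nat) Bj0) => s /eqP ks smin.
case: (arg_maxnP (fun i : 'I_q => i : nat) Bj0) => e /eqP ke emax.
have se : (s <= e)%N by apply: leq_trans (smin _ Bj0) (emax _ Bj0).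
have kblock i : (s <= i <= e)%N -> k i = k j0.
  move=> /andP[si ie]; have eq := ltn_ord e.
  by have := @k_mono s i ltac:(lia); have := @k_mono i e ltac:(lia); lia.
pose L := (e - s).+1.
pose Q := \poly_(l < L) v 0 (inord (s + l)).
have Qroot i : (s <= i <= e)%N -> root Q (w ^+ m i).
  move=> /[dup] sie /andP[si ie]; have eq := ltn_ord e.
  have iq : (i < q)%N by lia.
  move/matrixP: vM => /(_ 0 (Ordinal iq)); rewrite !mxE => vM.
  have wn0 : w != 0.
    apply/eqP => w0; have := prim_expr_order w_prim.
    by rewrite w0 expr0n => /esym/eqP; rewrite oner_eq0.
  suff: Q.[w ^+ m i] * w ^+ (m i * s) == 0.
    by rewrite mulf_eq0 (negPf (expf_neq0 _ wn0)) orbF.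
  rewrite -vM.
  rewrite horner_poly mulr_suml.
  rewrite [eqbRHS](bigID (fun j : 'I_q => (s <= j <= e)%N)) /=.
  rewrite [X in _ + X]big1 ?addr0; last first.
    move=> j sje; rewrite !mxE /= kblock // eq_sym.
    case: eqP => [kj|_]; last by rewrite mulr0.
    have Bj : B j by rewrite /= kj.
    by move: sje (emax _ Bj); rewrite (smin _ Bj) /geq /= => /negPf->.
  apply/eqP; rewrite -(big_mkord xpredT
     (fun l => v 0 (inord (s + l)) * (w ^+ m i) ^+ l * w ^+ (m i * s))).
  pose G j := v 0 (inord j) * w ^+ (m i * j).
  transitivity (\sum_(0 + s <= j < e.+1) G j).
    rewrite big_addn subSn //.
    apply: eq_bigr => l _; rewrite /G (addnC l s) mulnDr exprD.
    by rewrite (exprM w (m i) l) -mulrA; congr (_ * _); exact: mulrC.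
  rewrite add0n (@big_nat_widen _ _ _ s e.+1 q xpredT G); last exact: ltn_ord.
  rewrite (@big_nat_widenl _ _ _ s 0 q _ G) //.
  rewrite big_mkord; apply: eq_big => [j|j]; first by rewrite ltnS andbC.
  rewrite ltnS andbC => /= sje.
  by rewrite /G inord_val !mxE /= (kblock _ sie) (kblock _ sje) eqxx.
have Q0 : Q = 0.
  apply: (@roots_geq_poly_eq0 _ _ [seq w ^+ m i | i <- iota s L]).
  - apply/allP => _ /mapP[i + ->]; rewrite mem_iota => H.
    by apply: Qroot; move: H; rewrite /L; lia.
  - rewrite map_inj_in_uniq ?iota_uniq // => i j.
    rewrite !mem_iota => Hi Hj /eqP; rewrite (eq_prim_root_expr w_prim).
    have eq := ltn_ord e.
    have [iq jq] : (i < q)%N /\ (j < q)%N by rewrite /L in Hi Hj; lia.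
    rewrite !modn_small ?m_lt // => /eqP; apply: km_inj => //.
    by rewrite !kblock //; rewrite /L in Hi Hj; lia.
  - by rewrite size_map size_iota size_poly.
move/polyP: Q0 => /(_ (j0 - s)%N); rewrite coef_poly coef0.
have := smin _ Bj0; have := emax _ Bj0 => H1 H2.
by rewrite ltnS leq_sub2r // subnKC // inord_val => /eqP.
Qed.

Lemma chirp_minor_neq0 :
  \det (\matrix_(i < q, j < q)
     ((w ^+ (m i * j)) *: 'X^(chirp q ((j + q - k i) %% q))) : 'M[{poly F}]_q)
    != 0.
Proof.
set N := \matrix_(i, j) _.
(* The truncated subtraction is exact by [chirp_lower]. *)
pose g i j := (chirp q ((j + q - k i) %% q) + row_weight q k i + potential k j
                - (row_offset k i + col_weight q j))%N.
pose P : 'M[{poly F}]_q :=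
  \matrix_(i < q, j < q) ((w ^+ (m i * j)) *: 'X^(g i j)).
pose D (h : nat -> nat) : 'M[{poly F}]_q := diag_mx (\row_i 'X^(h i)).
have DNP : D (row_weight q k) *m N *m D (potential k)
         = D (row_offset k) *m P *m D (col_weight q).
  apply/matrixP => i j; rewrite /D !mul_mx_diag !mul_diag_mx !mxE.
  rewrite -!scalerAr -!scalerAl -!exprD; congr (_ *: 'X^_).
  have := chirp_lower k_mono k_le (ltn_ord i) (ltn_ord j).
  by rewrite /g; lia.
have Dn0 h : \det (D h) != 0.
  rewrite det_diag; apply/prodf_neq0 => i _.
  by rewrite mxE monic_neq0 // monicXn.
apply/eqP => N0; have := congr1 determinant DNP.
rewrite !det_mulmx N0 mulr0 mul0r => /esym/eqP.
(* At t = 0 only the entries with exponent 0 survive, which are those with k i = k j. *)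
rewrite !mulf_eq0 !(negPf (Dn0 _)) orbF /= => /eqP/(congr1 (horner_eval 0)).
rewrite -det_map_mx rmorph0 => /eqP; apply/negP.
rewrite (_ : map_mx _ P =
             \matrix_(i < q, j < q) (w ^+ (m i * j) *+ (k i == k j))).
  exact: block_vandermonde_det_neq0.
apply/matrixP => i j; rewrite !mxE /= /horner_eval hornerZ hornerXn expr0n.
have lo := chirp_lower k_mono k_le (ltn_ord i) (ltn_ord j).
have tg := chirp_tight k_mono k_le (ltn_ord i) (ltn_ord j).
rewrite (_ : (g i j == 0)%N = (k i == k j)) ?mulr_natr //.
by rewrite /g; case: eqP lo tg => /= [kij|kij] lo tg; [rewrite tg ?subnn|]; lia.
Qed.

End Minor.

Lemma exists_nonroot (F : numFieldType) (P : {poly F}) :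
  P != 0 -> exists t, P.[t] != 0.
Proof.
move=> P0; pose s : seq F := [seq i%:R | i <- iota 0 (size P)].
have : ~~ all (root P) s.
  apply: contra P0 => /roots_geq_poly_eq0 -> //.
    by rewrite map_inj_uniq ?iota_uniq // => i j /eqP; rewrite eqr_nat => /eqP.
  by rewrite size_map size_iota.
by case/allPn => t _ Pt; exists t.
Qed.

(** * From the minors to zeros of the Gabor transform *)

Section FullSpark.
Variables (F : numFieldType) (q' : nat).
Local Notation q := q'.+1.
Variable w : F.
Hypothesis w_prim : q.-primitive_root w.

Definition minor_matrix (D : {ffun 'I_q -> 'I_q * 'I_q}) : 'M[{poly F}]_q :=
  \matrix_(i < q, j < q)
     ((w ^+ ((D i).2 * j)) *: 'X^(chirp q ((j + q - (D i).1) %% q))).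

Definition ballot (D : {ffun 'I_q -> 'I_q * 'I_q}) :=
  [&& [forall i : 'I_q, forall j : 'I_q, (i <= j)%N ==> ((D i).1 <= (D j).1)%N],
      [forall i : 'I_q, ((D i).1 <= i)%N] & injectiveb D].

Lemma ballot_minor_neq0 D : ballot D -> \det (minor_matrix D) != 0.
Proof.
case/and3P => /forallP Dmono /forallP Dle /injectiveP Dinj.
pose k i := nat_of_ord (D (inord i)).1; pose m i := nat_of_ord (D (inord i)).2.
have -> : minor_matrix D = \matrix_(i < q, j < q)
     ((w ^+ (m i * j)) *: 'X^(chirp q ((j + q - k i) %% q))).
  by apply/matrixP => i j; rewrite !mxE /k /m inord_val.
apply: chirp_minor_neq0 => // [i j /andP[ij jq]|i iq|i iq|i j iq jq].
- have /forallP/(_ (inord j))/implyP := Dmono (inord i).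
  by apply; rewrite !inordK //; lia.
- by have := Dle (inord i); rewrite inordK.
- exact: ltn_ord.
- move=> /val_inj k_eq /val_inj m_eq.
  have /Dinj/(congr1 val) : D (inord i) = D (inord j).
    by rewrite [LHS]surjective_pairing k_eq m_eq -surjective_pairing.
  by rewrite /= !inordK.
Qed.

(** There are finitely many ballot minors, so a nonroot of their product serves all of them. *)
Lemma ballot_minors_common_nonroot :
  exists t : F, forall D, ballot D -> (\det (minor_matrix D)).[t] != 0.
Proof.
have [t Pt] : exists t, (\prod_(D | ballot D) \det (minor_matrix D)).[t] != 0.
  by apply: exists_nonroot; apply/prodf_neq0 => D; exact: ballot_minor_neq0.
by exists t => D bD; move: Pt; rewrite horner_prod => /prodf_neq0/(_ D bD).
Qed.

Lemma ballot_kernel t D (b : 'I_q -> F) :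
    (\det (minor_matrix D)).[t] != 0 ->
    (forall i : 'I_q, \sum_(j < q) w ^+ ((D i).2 * j)
       * t ^+ chirp q ((j + q - (D i).1) %% q) * b j = 0) ->
  forall j, b j = 0.
Proof.
move=> det_neq0 b_ker j; apply/eqP; apply: contraNT det_neq0 => bj.
change (horner_eval t (\det (minor_matrix D)) == 0); rewrite -det_map_mx -det_tr.
apply/det0P; exists (\row_j b j).
  by apply/rV0Pn; exists j; rewrite mxE.
apply/rowP => i; rewrite !mxE -[RHS](b_ker i); apply: eq_bigr => l _.
by rewrite !mxE; rewrite /= /horner_eval hornerZ hornerXn mulrC.
Qed.

(* The cycle lemma: starting at an index maximizing [c i - i], the      *)
(* rotated and renormalized sequence lies below the diagonal.                 *)
Lemma sorted_rotation (c : nat -> nat) :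
    (forall i j, (i <= j < q)%N -> (c i <= c j)%N) ->
    (forall i, (i < q)%N -> (c i < q)%N) ->
  exists (i0 : nat) (k : nat -> nat),
    [/\ (i0 < q)%N,
        forall i, (i < q)%N ->
          (k i + c i0 = c ((i0 + i) %% q) + q * ((i0 + i) %/ q))%N,
        forall i j, (i <= j < q)%N -> (k i <= k j)%N
      & forall i, (i < q)%N -> (k i <= i)%N].
Proof.
move=> c_mono c_lt.
(* Adding q keeps the natural subtraction exact. *)
case: (@arg_maxnP _ ord0 xpredT (fun i : 'I_q => c i + q - i)%N isT)
  => i0 _ i0max.
have i0q := ltn_ord i0.
have split i : (i < q)%N ->
    [/\ (i0 + i < q)%N, (i0 + i) %% q = i0 + i & (i0 + i) %/ q = 0]%N \/
    [/\ (q <= i0 + i)%N, (i0 + i) %% q = i0 + i - q & (i0 + i) %/ q = 1]%N.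
  move=> iq; case: (ltnP (i0 + i) q) => H; [left|right]; split=> //.
  - by rewrite modn_small.
  - by rewrite divn_small.
  - by rewrite -{1}(subnK H) modnDr modn_small //; lia.
  - by rewrite -{1}(subnK H) divnDr // divnn divn_small //; lia.
exists i0, (fun i => c ((i0 + i) %% q) + q * ((i0 + i) %/ q) - c i0)%N.
split => //.
- move=> i iq; rewrite subnK //; have [[H -> ->]|[H -> ->]] := split i iq.
    by have := c_mono i0 (i0 + i)%N; lia.
  by have := c_lt _ i0q; lia.
- move=> i j /andP[ij jq]; have iq : (i < q)%N by lia.
  have [[H -> ->]|[H -> ->]] := split i iq;
    have [[H' -> ->]|[H' -> ->]] := split j jq.
  + by have := c_mono (i0 + i)%N (i0 + j)%N; lia.
  + by have := c_lt (i0 + i)%N H; lia.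
  + by lia.
  + by have := c_mono (i0 + i - q)%N (i0 + j - q)%N; lia.
- move=> i iq; have [[H -> ->]|[H -> ->]] := split i iq.
    have := i0max (Ordinal H) isT; rewrite /geq /=.
    by have := c_mono i0 (i0 + i)%N; lia.
  have H' : (i0 + i - q < q)%N by lia.
  by have := i0max (Ordinal H') isT; rewrite /geq /=; lia.
Qed.

Definition gabor_zeros (a : nat -> F) (b : 'I_q -> F) : {set 'I_q * 'I_q} :=
  [set km : 'I_q * 'I_q |
     \sum_(j < q) w ^+ (km.2 * j) * a ((j + q - km.1) %% q)%N * b j == 0].

(** Any q zeros, sorted by translation, become a ballot family after a rotation; the corresponding
    minor is invertible at t, which forces b = 0. *)
Lemma gabor_full_spark :
  exists a : nat -> F, forall b : 'I_q -> F, (exists j, b j != 0) ->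
    (#|gabor_zeros a b| < q)%N.
Proof.
have [t Ht] := ballot_minors_common_nonroot.
exists (fun e => t ^+ chirp q e) => b [j0 bj0].
rewrite ltnNge; apply/negP => Zq; move/negP: bj0; apply.
set Z := gabor_zeros _ _ in Zq.
pose le1 := [rel u v : 'I_q * 'I_q | (u.1 <= v.1)%N].
pose s := take q (sort le1 (enum Z)).
have le1_total : total le1 by move=> u v; exact: leq_total.
have le1_trans : transitive le1 by move=> v u u'; exact: leq_trans.
have s_size : size s = q.
  by rewrite size_takel // size_sort -cardE.
have s_uniq : uniq s by rewrite take_uniq // sort_uniq enum_uniq.
have s_sorted : sorted le1 s by rewrite take_sorted // sort_sorted.
have s_Z u : u \in s -> u \in Z.
  by move/mem_take; rewrite mem_sort mem_enum.
pose S i := nth (ord0, ord0) s i.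
have SZ i : (i < q)%N -> S i \in Z by move=> iq; rewrite s_Z // mem_nth ?s_size.
pose c i := nat_of_ord (S i).1.
have c_mono i j : (i <= j < q)%N -> (c i <= c j)%N.
  move=> /andP[ij jq].
  apply: (sorted_leq_nth le1_trans _ (ord0, ord0) s_sorted) => //.
  - by move=> u; exact: leqnn.
  - by rewrite inE s_size; lia.
  - by rewrite inE s_size.
have c_lt i : (i < q)%N -> (c i < q)%N by move=> _; exact: ltn_ord.
have [i0 [k [i0q kE k_mono k_le]]] := sorted_rotation c_mono c_lt.
pose D := [ffun i : 'I_q => (inord (k i) : 'I_q, (S ((i0 + i) %% q)%N).2)].
have D1 (i : 'I_q) : (D i).1 = k i :> nat.
  by rewrite ffunE /= inordK // (leq_ltn_trans (k_le _ (ltn_ord i))).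
have bD : ballot D.
  apply/and3P; split.
  - apply/forallP => i; apply/forallP => j; apply/implyP => ij.
    by rewrite !D1 k_mono // ij ltn_ord.
  - by apply/forallP => i; rewrite D1 k_le.
  - apply/injectiveP => i j Dij; apply/val_inj => /=.
    have k_eq : k i = k j by rewrite -!D1 Dij.
    have c_eq : c ((i0 + i) %% q)%N = c ((i0 + j) %% q)%N.
      have := kE _ (ltn_ord j); rewrite -k_eq kE // => /(congr1 (modn^~ q)).
      by rewrite !(mulnC q) ![(c _ + _)%N]addnC !modnMDl
                 !(modn_small (c_lt _ _)) ?ltn_pmod.
    have S_eq : S ((i0 + i) %% q)%N = S ((i0 + j) %% q)%N.
      rewrite [LHS]surjective_pairing (val_inj c_eq).
      have := congr1 snd Dij; rewrite !ffunE /= => ->.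
      by rewrite -surjective_pairing.
    have /eqP := S_eq; rewrite nth_uniq ?s_size ?ltn_pmod //.
    by rewrite eqn_modDl !modn_small // => /eqP.
(* Shifting b by c i0 subtracts c i0 from every translation and multiplies each equation by a power
   of w, restored below as the factor [w0]. *)
pose b' (j : 'I_q) := b (inord ((j + c i0) %% q)).
have shift_inj : injective (fun j : 'I_q => inord ((j + c i0) %% q) : 'I_q).
  move=> i j /(congr1 val) /=; rewrite !inordK ?ltn_pmod // => /eqP.
  by rewrite eqn_modDr !modn_small // => /eqP/val_inj.
suff b'0 j : b' j = 0.
  have [g fK gK] := injF_bij shift_inj.
  by have := b'0 (g j0); rewrite /b' gK => ->.
apply: (ballot_kernel (Ht D bD)) => {j} i.
have w0 : w ^+ ((D i).2 * c i0) != 0.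
  apply: expf_neq0; apply/eqP => w0; have := prim_expr_order w_prim.
  by rewrite w0 expr0n => /esym/eqP; rewrite oner_eq0.
apply: (mulIf w0); rewrite mul0r mulr_suml.
have /SZ : ((i0 + i) %% q < q)%N by rewrite ltn_pmod.
rewrite inE => /eqP Z0; rewrite -[RHS]Z0 [RHS](reindex_inj shift_inj) /=.
apply: eq_bigr => l _; rewrite mulrAC (mulrAC (w ^+ _)) -exprD -mulnDr.
congr (_ * _ * _); last first.
  rewrite D1 inordK ?ltn_pmod //; congr (t ^+ chirp _ _).
  have := kE _ (ltn_ord i); have := k_le _ (ltn_ord i); have := ltn_ord i.
  have : (c ((i0 + i) %% q) < q)%N by rewrite c_lt ?ltn_pmod.
  rewrite -[nat_of_ord (S _).1]/(c _); move: (c _) (k i) => cc kk cq iq ki kk_eq.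
  apply/eqP; rewrite -(eqn_modDr cc) subnK ?modnDr ?modn_mod; last by lia.
  rewrite -(modnMDl ((i0 + i) %/ q)) (_ : _ + _ = l + c i0 + q)%N ?modnDr //.
  by lia.
apply/eqP; rewrite (eq_prim_root_expr w_prim).
by rewrite inordK ?ltn_pmod // ffunE /= modnMmr.
Qed.
End FullSpark.

(** * Induced representations *)

Lemma mx_Schur_scalar (C : closedFieldType) (gT : finGroupType)
    (G : {group gT}) (n : nat) (rG : mx_representation C G n) (A : 'M[C]_n) :
    mx_irreducible rG -> (forall x, x \in G -> A *m rG x = rG x *m A) ->
  exists a, A = a%:M.
Proof.
move=> irrG cGA; have [n_gt0 _] := (mx_irrP rG).1 irrG.
have [a Aa] : exists a, eigenvalue A a.
  have [|a ra] := closed_rootP (char_poly A) _.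
    by rewrite size_char_poly; lia.
  by exists a; rewrite eigenvalue_root_char.
exists a; apply/eqP; rewrite -subr_eq0; apply: contraTT Aa => nz.
rewrite /eigenvalue /eigenspace negbK kermx_eq0 row_free_unit (mx_Schur irrG) //.
apply/centgmxP => x Gx.
by rewrite mulmxBl mulmxBr cGA // scalar_mxC.
Qed.

Lemma natr_card (R : pzSemiRingType) (A : finType) (S : {set A}) :
  #|S|%:R = \sum_t (t \in S)%:R :> R.
Proof.
rewrite -sum1_card natr_sum [LHS]big_mkcond; apply: eq_bigr => t _.
by case: ifP.
Qed.

Section Inner.
Variables (R : realType) (n : nat).
Implicit Types u v : 'cV[R[i]]_n.

Lemma inner_mulmx u v : inner u v = (u^T *m map_mx Num.conj v) 0 0.
Proof. by rewrite mxE; apply: eq_bigr => i _; rewrite !mxE. Qed.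

Lemma inner_unitary (U : 'M[R[i]]_n) u v : U \is unitarymx ->
  inner (U *m u) (U *m v) = inner u v.
Proof.
rewrite -trmx_unitary => /unitarymxP; rewrite trmxK => UU.
by rewrite !inner_mulmx trmx_mul map_mxM mulmxA -(mulmxA u^T) UU mulmx1.
Qed.

Lemma innerZr (a : R[i]) u v : inner u (a *: v) = Num.conj a * inner u v.
Proof.
rewrite /inner mulr_sumr; apply: eq_bigr => i _.
by rewrite mxE rmorphM mulrCA.
Qed.

Lemma inner0l v : inner 0 v = 0.
Proof. by rewrite /inner big1 // => i _; rewrite mxE mul0r. Qed.

Lemma inner_eq0 u : inner u u = 0 -> u = 0.
Proof.
move/eqP; rewrite /inner psumr_eq0 => [/allP u0|i _]; last exact: mul_conjC_ge0.
apply/colP => i; rewrite mxE; apply/eqP.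
by rewrite -mul_conjC_eq0; apply: u0; rewrite mem_index_enum.
Qed.

End Inner.

(** * Consequences of the intertwiner with the induced representation *)

Section Induced.

Variables (R : realType) (gT : finGroupType) (G H : {group gT}) (n d : nat).
Variables (pi : mx_representation R[i] G n) (tau : mx_representation R[i] H d).
Variable T : {linear 'cV[R[i]]_n -> {ffun gT -> 'cV[R[i]]_d}}.
Hypothesis T_range : forall F, ind_space G tau F <-> exists v, T v = F.
Hypothesis T_isom : forall u v, ind_inner G H (T u) (T v) = inner u v.
Hypothesis T_equivar : forall x v, x \in G -> T (pi x *m v) = ind_act x (T v).
Hypothesis sHG : H \subset G.

Lemma intertwiner_inj : injective T.
Proof.
move=> u v eqT; apply/eqP; rewrite -subr_eq0; apply/eqP/inner_eq0.
rewrite -T_isom linearB eqT subrr /ind_inner big1 ?mulr0 // => g _.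
by rewrite ffunE inner0l.
Qed.

Lemma ind_space_intertwiner v : ind_space G tau (T v).
Proof. by apply/T_range; exists v. Qed.

Definition ind_delta (s : gT) (u : 'cV[R[i]]_d) : {ffun gT -> 'cV[R[i]]_d} :=
  [ffun g => if (s^-1 * g)%g \in H then tau (s^-1 * g)^-1%g *m u else 0].

Lemma ind_space_delta s u : s \in G -> ind_space G tau (ind_delta s u).
Proof.
move=> Gs; split=> [g|g h Gg Hh]; rewrite !ffunE.
  case: ifP => // Hsg; case/negP.
  by rewrite -(mulKVg s g) groupM // (fintype.subsetP sHG).
rewrite mulgA groupMr //; case: ifP => [Hsg|]; last by rewrite mulmx0.
by rewrite invMg repr_mxM ?groupV // mulmxA.
Qed.

(** Pointwise application of tau(c) preserves the induced space and commutes with left translation,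
    so Schur's lemma for pi makes it a scalar. Functions supported on the coset H recover tau(c)
    itself. *)
Lemma repr_center_scalar c : mx_irreducible pi -> c \in 'Z(H)%g ->
  exists a, tau c = a%:M.
Proof.
move=> irr /centerP[Hc cHc].
have tauC h : h \in H -> tau c *m tau h = tau h *m tau c.
  by move=> Hh; rewrite -!repr_mxM // cHc.
pose A_ v := [ffun g => tau c *m T v g].
have A_ind v : ind_space G tau (A_ v).
  have [T0 TH] := ind_space_intertwiner v.
  split=> [g /T0|g h Gg Hh]; rewrite !ffunE; first by move->; rewrite mulmx0.
  rewrite (TH _ _ Gg Hh) [LHS]mulmxA [RHS]mulmxA; congr (_ *m _).
  by apply: tauC; rewrite groupV.
pose e (i : 'I_n) : 'cV[R[i]]_n := delta_mx i 0.
have /choice [a_ a_E] : forall i, exists v, T v = A_ (e i).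
  by move=> i; apply/T_range.
pose A := \matrix_(i, j) a_ j i 0.
have TA v : T (A *m v) = A_ v.
  have -> : A *m v = \sum_i v i 0 *: a_ i.
    apply/colP => j; rewrite summxE !mxE; apply: eq_bigr => i _.
    by rewrite !mxE mulrC.
  have {2}-> : v = \sum_i v i 0 *: e i.
    by rewrite {1}[v]matrix_sum_delta; apply: eq_bigr => i _; rewrite big_ord1.
  apply/ffunP => g; rewrite ffunE !linear_sum !sum_ffunE mulmx_sumr.
  by apply: eq_bigr => i _; rewrite !linearZ /= a_E !ffunE scalemxAr.
have [a AE] : exists a, A = a%:M.
  apply: (mx_Schur_scalar irr) => x Gx; apply/matrixP => i j.
  have colM (B : 'M[R[i]]_n) : B i j = (B *m e j) i 0 by rewrite -colE mxE.
  rewrite colM [RHS]colM; congr (fun_of_matrix _ i 0); apply: intertwiner_inj.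
  rewrite -!mulmxA TA !T_equivar //; apply/ffunP => g.
  by rewrite !ffunE T_equivar // TA !ffunE.
exists a; apply/matrixP => i j.
have [v Tv] := (T_range _).1 (ind_space_delta (delta_mx j 0) (group1 G)).
have := TA v; rewrite AE mul_scalar_mx linearZ /= => /ffunP/(_ 1%g).
rewrite !ffunE Tv !ffunE !(mulg1, invg1) group1 !repr_mx1 !mul1mx.
by rewrite -colE => /matrixP/(_ i 0); rewrite !mxE eqxx andbT mulr_natr => <-.
Qed.

(** For central c, F(c^-1 g) = F(g c^-1) = tau(c) F(g), so pi(c) is trivial when tau(c) is. *)
Lemma repr_center_faithful c : mx_faithful pi -> c \in 'Z(G)%g -> c \in H ->
  tau c = 1%:M -> c = 1%g.
Proof.
move=> /fintype.subsetP faith /centerP[Gc cGc] Hc tau1.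
apply/set1P/faith/rkerP; split=> //.
apply/matrixP => i j; pose e : 'cV[R[i]]_n := delta_mx j 0.
have colM (B : 'M[R[i]]_n) : B i j = (B *m e) i 0 by rewrite -colE mxE.
rewrite colM [RHS]colM; congr (fun_of_matrix _ i 0); apply: intertwiner_inj.
rewrite T_equivar // mul1mx; apply/ffunP => g; rewrite ffunE.
have [T0 TH] := ind_space_intertwiner e.
have [Gg|Gg] := boolP (g \in G); last first.
  by rewrite !T0 // groupMl ?groupV.
rewrite -[(c^-1 * g)%g]invgK invMg invgK -cGc ?groupV // invMg invgK.
by rewrite TH ?groupV // invgK tau1 mul1mx.
Qed.

(** * Voice transforms along the transversal of powers of x *)

Section Transversal.

Variables (q' : nat) (x : gT).
Local Notation q := q'.+1.
Hypothesis Gx : x \in G.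
Hypothesis nHG : (H <| G)%g.
Hypothesis Gq : #|G| = (q * #|H|)%N.
Hypothesis x_free : forall i j : 'I_q, (x ^- i * x ^+ j)%g \in H -> i = j.
Hypothesis xq1 : (x ^+ q = 1)%g.
Hypothesis tau_unitary : unitary_repr tau.

Lemma big_transversal (V : nmodType) (phi : gT -> V) :
  \sum_(g in G) phi g = \sum_(j < q) \sum_(h in H) phi (x ^+ j * h)%g.
Proof.
pose f (jh : 'I_q * gT) := (x ^+ jh.1 * jh.2)%g.
pose A := finset.setX (finset.setT : {set 'I_q}) H.
have f_inj : {in A &, injective f}.
  move=> [i h] [j h'] /finset.setXP[_ Hh] /finset.setXP[_ Hh'] /= fE.
  rewrite /f /= in fE.
  have ij : i = j.
    apply: x_free; rewrite -(mulgK h' (x ^+ j)%g) -fE !mulgA mulVg mul1g.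
    by rewrite groupM // groupV.
  by move: fE; rewrite ij => /mulgI ->.
have <- : f @: A = G.
  apply/eqP; rewrite eqEcard card_in_imset //.
  rewrite cardsX cardsT card_ord Gq leqnn andbT.
  apply/fintype.subsetP => _ /imsetP[[i h] /finset.setXP[_ Hh] ->].
  by rewrite groupM ?groupX // (fintype.subsetP sHG).
rewrite big_imset //= pair_big_dep /=; apply: eq_bigl => -[i h].
by rewrite !inE.
Qed.

Lemma big_conj_transversal j (V : nmodType) (phi : gT -> V) :
  \sum_(h in H) phi (h ^ (x ^+ j))%g = \sum_(h in H) phi h.
Proof.
rewrite [RHS](reindex_inj (conjg_inj (x ^+ j)%g)); apply: eq_bigl => h.
by rewrite memJ_norm // (fintype.subsetP (normal_norm nHG)) ?groupX.
Qed.

Lemma big_transversalr (V : nmodType) (phi : gT -> V) :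
  \sum_(g in G) phi g = \sum_(j < q) \sum_(h in H) phi (h * x ^+ j)%g.
Proof.
rewrite big_transversal; apply: eq_bigr => j _.
rewrite -(big_conj_transversal j); apply: eq_bigr => h _.
by rewrite conjgE mulKVg.
Qed.

(** By unitarity of tau the summand is constant on each coset of H, which cancels the factor
    1/|H|. *)
Lemma voice_transversal eta f u : u \in G ->
  voice pi eta f u =
  \sum_(j < q) inner (T f (x ^+ j)%g) (T eta (u^-1 * x ^+ j)%g).
Proof.
move=> Gu; rewrite /voice -T_isom T_equivar // /ind_inner big_transversal.
have [_ TfH] := ind_space_intertwiner f.
have [_ TeH] := ind_space_intertwiner eta.
rewrite mulr_sumr; apply: eq_bigr => j _.
rewrite (eq_bigr (fun=> inner (T f (x ^+ j)%g) (T eta (u^-1 * x ^+ j)%g))).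
  by rewrite sumr_const -(mulr_natl (inner _ _)) mulKf //
             pnatr_eq0 -lt0n cardG_gt0.
move=> h Hh; rewrite ffunE mulgA TfH ?groupX // TeH ?groupM ?groupV ?groupX //.
by rewrite inner_unitary // tau_unitary // groupV.
Qed.

Lemma intertwiner_transversal_neq0 f :
  f != 0 -> exists j : 'I_q, T f (x ^+ j)%g != 0.
Proof.
move=> f0; apply/existsP; apply: contraNT f0 => /existsPn Tf0.
have [T0 TH] := ind_space_intertwiner f.
rewrite -(inj_eq intertwiner_inj) linear0; apply/eqP/ffunP => g.
rewrite [RHS]ffunE.
have [Gg|/T0//] := boolP (g \in G).
(* Summing the indicator of g over the transversal shows that g lies in some x^j H. *)
have : \sum_(g' in G) (g' == g)%:R != 0 :> nat.
  by rewrite (bigD1 g) //= eqxx.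
rewrite big_transversal; apply: contraNeq => Tg; rewrite big1 // => j _.
rewrite big1 // => h Hh; case: eqP => // gE; case/negP: Tg.
by rewrite -gE TH ?groupX // (eqP (negbNE (Tf0 j))) mulmx0.
Qed.

Lemma exists_transversal_vector (a : nat -> R[i]) (u : 'cV[R[i]]_d) :
  exists eta, forall i h, (i < q)%N -> h \in H ->
    T eta (x ^+ i * h)%g = a i *: (tau h^-1%g *m u).
Proof.
have /choice [v_ vE] : forall j : 'I_q, exists v, T v = ind_delta (x ^+ j)%g u.
  by move=> j; apply/T_range/ind_space_delta; rewrite groupX.
exists (\sum_(j < q) a j *: v_ j) => i h iq Hh.
rewrite linear_sum sum_ffunE (bigD1 (Ordinal iq)) //= big1 ?addr0.
  by rewrite linearZ /= vE !ffunE mulKg Hh.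
move=> j ji; rewrite linearZ /= vE !ffunE mulgA groupMr //.
case: ifP => [/(@x_free j (Ordinal iq)) jE|_]; last by rewrite scaler0.
by rewrite jE eqxx in ji.
Qed.

(** Since x^q = 1, x^-k x^j is exactly the transversal element of index j - k mod q, with no extra
    factor in H. *)
Lemma voice_transversal_vector (a : nat -> R[i]) (u : 'cV[R[i]]_d) eta f h k :
    (forall i h, (i < q)%N -> h \in H ->
      T eta (x ^+ i * h)%g = a i *: (tau h^-1%g *m u)) ->
    (k < q)%N -> h \in H ->
  voice pi eta f (h * x ^+ k)%g =
  \sum_(j < q) Num.conj (a ((j + q - k) %% q)%N)
    * inner (T f (x ^+ j)%g) (tau (h ^ (x ^+ j))%g *m u).
Proof.
move=> etaE kq Hh; have hG := fintype.subsetP sHG h Hh.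
rewrite voice_transversal ?groupM ?groupX //; apply: eq_bigr => j _.
have xE : (x ^+ ((j + q - k) %% q) = x ^- k * x ^+ j)%g.
  rewrite expg_mod //; apply: (mulgI (x ^+ k)%g); rewrite mulKVg -expgD.
  by rewrite subnKC ?expgD ?xq1 ?mulg1 //; lia.
rewrite (_ : (_ * _) = x ^+ ((j + q - k) %% q) * (h ^ (x ^+ j))^-1)%g.
  rewrite etaE ?ltn_pmod // ?groupV ?invgK ?innerZr //.
  by rewrite memJ_norm // (fintype.subsetP (normal_norm nHG)) ?groupX.
by rewrite xE -conjVg conjgE invMg -!mulgA mulKVg.
Qed.

(** * Counting zeros through the Gabor transform *)

Section Zeros.

Variables (y z : gT) (ly lz : R[i]).
Hypotheses (Hy : y \in H) (Hz : z \in H).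
Hypotheses (tau_y : tau y = ly%:M) (tau_z : tau z = lz%:M).
Hypotheses (ly_neq0 : ly != 0) (lz_prim : q.-primitive_root lz).
Hypothesis yJx : forall j, (y ^ (x ^+ j) = y * z ^- j)%g.

Let w := Num.conj lz^-1.

Lemma twist_prim : q.-primitive_root w.
Proof.
rewrite fmorph_primitive_root; apply: etrans lz_prim; congr andb.
by apply: eq_forallb => i; rewrite !unity_rootE exprVn invr_eq1.
Qed.

Lemma repr_twist h j m : h \in H ->
  tau ((h * y ^+ m) ^ (x ^+ j))%g =
  (ly ^+ m * lz^-1 ^+ (m * j)) *: tau (h ^ (x ^+ j))%g.
Proof.
move=> Hh; have nHx : (x ^+ j)%g \in 'N(H)%g.
  by rewrite (fintype.subsetP (normal_norm nHG)) ?groupX.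
have tauX c a e : c \in H -> tau c = a%:M -> tau (c ^+ e)%g = (a ^+ e)%:M.
  move=> Hc tau_c; elim: e => [|e IHe]; first by rewrite expg0 repr_mx1 expr0.
  by rewrite expgS repr_mxM ?groupX // tau_c IHe -scalar_mxM exprS.
have tau_zV : tau z^-1%g = (lz^-1)%:M by rewrite repr_mxV // tau_z invmx_scalar.
have tau_yz : tau (y * z ^- j)%g = (ly * lz^-1 ^+ j)%:M.
  rewrite repr_mxM ?groupV ?groupX // tau_y -expgVn (tauX _ lz^-1) ?groupV //.
  by rewrite -scalar_mxM.
have Hyz : (y * z ^- j)%g \in H by rewrite groupM ?groupV ?groupX.
rewrite conjMg conjXg yJx repr_mxM ?memJ_norm ?(groupX _ Hyz) //.
rewrite (tauX _ _ _ Hyz tau_yz) mul_mx_scalar.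
by rewrite exprMn -exprM mulnC.
Qed.

Lemma voice_zeros_gabor a u eta f h (k m : 'I_q) :
    (forall i h, (i < q)%N -> h \in H ->
      T eta (x ^+ i * h)%g = Num.conj (a i) *: (tau h^-1%g *m u)) ->
    h \in H ->
  (voice pi eta f (h * y ^+ m * x ^+ k)%g == 0) =
  ((k, m) \in gabor_zeros w a
     (fun j => inner (T f (x ^+ j)%g) (tau (h ^ (x ^+ j))%g *m u))).
Proof.
move=> etaE Hh; rewrite inE /=.
have Hhy : (h * y ^+ m)%g \in H by rewrite groupM ?groupX.
rewrite (voice_transversal_vector f etaE (ltn_ord k) Hhy).
rewrite -[RHS](mulrI_eq0 _ (mulfI (_ : Num.conj ly ^+ m != 0))); last first.
  by rewrite expf_neq0 // conjC_eq0.
rewrite mulr_sumr; congr (_ == 0); apply: eq_bigr => j _.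
rewrite repr_twist // -scalemxAl innerZr conjCK rmorphM !rmorphXn /= -/w.
ring.
Qed.

(** [f0] is a nonzero value of F = T f at some x^j0. When the entry b_h(j0) is nonzero, the spark
    property applies to b_h; the h where it vanishes correspond, by conjugation by x^j0, to the
    zeros of [voice tau u f0]. *)
Lemma sum_voice_zeros a u eta f :
    (forall b, (exists j, b j != 0) -> (#|@gabor_zeros _ q' w a b| < q)%N) ->
    (forall i h, (i < q)%N -> h \in H ->
      T eta (x ^+ i * h)%g = Num.conj (a i) *: (tau h^-1%g *m u)) ->
    f != 0 ->
  exists2 f0, f0 != 0 &
    q%:R * \sum_(g in G) (voice pi eta f g == 0)%:R
      <= q%:R ^+ 2 * \sum_(h in H) (voice tau u f0 h == 0)%:R
         + (q%:R - 1) * #|H|%:R :> R.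
Proof.
move=> a_spark etaE f_neq0.
have [j0 Fj0] := intertwiner_transversal_neq0 f_neq0.
exists (T f (x ^+ j0)%g) => //.
pose b h (j : 'I_q) := inner (T f (x ^+ j)%g) (tau (h ^ (x ^+ j))%g *m u).
have -> : \sum_(h in H) (voice tau u (T f (x ^+ j0)%g) h == 0)%:R
        = \sum_(h in H) (b h j0 == 0)%:R :> R.
  exact: esym (big_conj_transversal j0 (fun h => (voice tau u _ h == 0)%:R)).
have -> : q%:R * \sum_(g in G) (voice pi eta f g == 0)%:R
        = \sum_(h in H) #|gabor_zeros w a (b h)|%:R :> R.
  rewrite big_transversalr.
  transitivity (\sum_(m < q) \sum_(k < q) \sum_(h in H)
      (voice pi eta f (h * y ^+ m * x ^+ k)%g == 0)%:R : R).
    (* For each m, h |-> h y^m permutes H, so all q inner sums are equal. *)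
    set S := (X in _ * X); rewrite [RHS](eq_bigr (fun=> S)).
      by rewrite sumr_const card_ord mulr_natl.
    move=> m _; apply: eq_bigr => k _; 
    rewrite [RHS](reindex_inj (mulIg (y ^+ m)%g)) /=.
    by apply: eq_bigl => h; rewrite groupMr ?groupX.
  rewrite exchange_big pair_big exchange_big /=; apply: eq_bigr => h Hh.
  rewrite natr_card; apply: eq_bigr => -[k m] _ /=.
  by rewrite (voice_zeros_gabor f _ _ etaE).
have -> : (q%:R - 1) * #|H|%:R = \sum_(h in H) (q%:R - 1) :> R.
  by rewrite sumr_const mulr_natr.
rewrite mulr_sumr -big_split /=.
(* The term q - 1 is charged to every h, including those where only the trivial bound q^2 holds. *)
apply: ler_sum => h Hh; case: eqP => [_|/eqP bh].
  rewrite mulr1 -natrX; apply: le_trans (_ : (q ^ 2)%:R <= _).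
    by rewrite ler_nat (leq_trans (max_card _)) // card_prod card_ord.
  by rewrite lerDl subr_ge0 ler1n.
rewrite mulr0 add0r -[X in _ - X]/(1%:R) -natrB // ler_nat.
by rewrite -ltnS subn1 /= a_spark //; exists j0.
Qed.

End Zeros.
End Transversal.
End Induced.

(** * Split K-triples *)

Section KElements.

Variables (gT : finGroupType) (p : nat) (G G0 : {group gT}) (r : nat).
Variables (x y z : gT).
Hypotheses (p_prime : prime p) (nG0G : (G0 <| G)%g).
Hypothesis K : K_elements G p G0 r x y z.

Lemma K_order_coset : #[coset G0 x]%g = (p ^ r)%N.
Proof.
case: K => _ _ _ [GE /card_isog /=]; rewrite GE -orderE => ->.
by rewrite card_Zp // expn_gt0 prime_gt0.
Qed.

Lemma K_order_z : #[z]%g = (p ^ r)%N.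
Proof.
case: K => _ [_ zE + _] _; rewrite -zE => /card_isog.
by rewrite card_Zp // expn_gt0 prime_gt0.
Qed.

Lemma K_card : #|G| = (p ^ r * #|G0|)%N.
Proof.
case: K => _ _ _ [GE _]; rewrite -K_order_coset orderE -GE.
by rewrite card_quotient ?normal_norm // mulnC Lagrange // normal_sub.
Qed.

Lemma K_transversal (i j : 'I_(p ^ r)) : (x ^- i * x ^+ j)%g \in G0 -> i = j.
Proof.
have Nx : x \in 'N(G0)%g.
  by case: K => [[Gx _ _] _ _ _]; rewrite (fintype.subsetP (normal_norm nG0G)).
move=> Hx; have : coset G0 (x ^- i * x ^+ j)%g = 1%g by apply: coset_id.
rewrite morphM ?groupV ?groupX // morphV ?groupX // !morphX //.
move/(canRL (mulKg _)); rewrite invgK mulg1 => /esym/eqP.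
by rewrite eq_expg_mod_order K_order_coset !modn_small // => /eqP/val_inj.
Qed.

Lemma K_central_y : y \in 'Z(G0)%g.
Proof.
case: K => [[_ /setDP[/setIdP[Gy _] _] _] _ G0E _].
apply/centerP; split; first by rewrite G0E inE Gy cent1id.
by move=> h; rewrite G0E inE => /andP[_ /cent1P].
Qed.

Lemma K_sub_z : z \in G0.
Proof.
case: K => [[_ _ /centerP[Gz cGz]] _ G0E _].
rewrite G0E inE Gz; apply/cent1P; apply: cGz.
by case: K => [[_ /setDP[/setIdP[Gy _] _] _] _ _ _].
Qed.

Lemma K_conj_y j : (y ^ (x ^+ j) = y * z ^- j)%g.
Proof.
case: K => [[Gx _ /centerP[_ cGz]] [zE _ _] _ _].
elim: j => [|j IHj]; first by rewrite conjg1 invg1 mulg1.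
have zx : (z ^ x = z)%g by apply/conjg_fixP/commgP; exact: cGz.
have yx : (y ^ x = y * z^-1)%g.
  by rewrite -zE commgEr invMg conjVg invgK mulKVg.
rewrite expgSr conjgM IHj conjMg yx conjVg conjXg zx expgS invMg.
by rewrite -mulgA -!expgVn -expgS -expgSr.
Qed.

End KElements.

Lemma sum_voice_zeros_card (R : realType) (gT : finGroupType) (G : {group gT})
    (n : nat) (rG : mx_representation R[i] G n) eta f :
  \sum_(g in G) (voice rG eta f g == 0)%:R =
  #|G|%:R - #|voice_supp rG eta f|%:R :> R.
Proof.
rewrite -[#|G|]sum1_card -[#|voice_supp _ _ _|]sum1_card !natr_sum.
apply/eqP; rewrite eq_sym subr_eq; apply/eqP.
rewrite [X in _ + X](eq_bigl (fun g => (g \in G) && (voice rG eta f g != 0))).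
  rewrite [X in _ + X]big_mkcondr -big_split /=; apply: eq_bigr => g _.
  by case: eqP; rewrite ?addr0 ?add0r.
by move=> g; rewrite inE.
Qed.

Theorem lemma32 (R : realType) (gT : finGroupType) (p : nat)
    (G : {group gT}) (n : nat) (pi : mx_representation R[i] G n)
    (G0 : {group gT}) (r d : nat) (tau : mx_representation R[i] G0 d)
    (p_prime : prime p) (pG : (p.-group G)%g) (nabG : ~~ abelian G)
    (pi_unitary : unitary_repr pi) (pi_faithful : mx_faithful pi)
    (pi_irr : mx_irreducible pi)
    (K : split_K_triple pi p r tau) :
  p0 pi <= p0 tau + (p%:R ^+ r - 1) / p%:R ^+ (2 * r).
Proof.
case: K => nG0G tau_unitary [T [T_range T_isom T_equivar]] [x [y [z [K xq]]]].
have [n_gt0 _] := (mx_irrP pi).1 pi_irr.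
have sG0G := normal_sub nG0G.
have T_inj := intertwiner_inj T_isom.
have d_gt0 : (0 < d)%N.
  rewrite lt0n; apply/eqP => d0.
  have /T_inj/matrixP/(_ (Ordinal n_gt0) 0) : T (const_mx 1) = T 0.
    apply/ffunP => g; apply/matrixP => i; exfalso.
    by have := ltn_ord i; rewrite [X in (_ < X)%N]d0.
  by rewrite !mxE => /eqP; rewrite oner_eq0.
have Gx : x \in G by case: K => [[]].
have zZ : z \in 'Z(G)%g by case: K => [[]].
have yZ0 := K_central_y K; have Hy := fintype.subsetP (center_sub G0) _ yZ0.
have Hz := K_sub_z K.
have zZ0 : z \in 'Z(G0)%g.
  apply/centerP; split=> // h Hh; case/centerP: zZ => _; apply.
  exact: (fintype.subsetP sG0G).
have [ly tau_y] := repr_center_scalar T_range T_isom T_equivar sG0G pi_irr yZ0.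
have [lz tau_z] := repr_center_scalar T_range T_isom T_equivar sG0G pi_irr zZ0.
have scalar_neq0 c a : c \in G0 -> tau c = a%:M -> a != 0.
  move=> Hc tau_c; have := repr_mx_unit tau Hc.
  by rewrite tau_c unitmxE det_scalar unitfE expf_eq0 d_gt0.
have [q' qE] : exists q', (p ^ r = q'.+1)%N.
  by exists (p ^ r).-1; rewrite prednK // expn_gt0 prime_gt0.
(* The order of lz equals that of z: lz^m = 1 makes tau(z^m) trivial, hence z^m = 1 by faithfulness
   of pi. *)
have lz_prim : q'.+1.-primitive_root lz.
  have tau_zX m : tau (z ^+ m)%g = (lz ^+ m)%:M.
    elim: m => [|m IHm]; first by rewrite repr_mx1.
    by rewrite expgS repr_mxM ?groupX // tau_z IHm -scalar_mxM exprS.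
  have zX m : lz ^+ m = 1 -> (q'.+1 %| m)%N.
    move=> lz1; rewrite -qE -(K_order_z p_prime K) order_dvdn.
    apply/eqP/(repr_center_faithful T_range T_isom T_equivar pi_faithful).
    - by rewrite groupX.
    - by rewrite groupX.
    - by rewrite tau_zX lz1.
  have lzq : lz ^+ q'.+1 = 1.
    have := tau_zX q'.+1; rewrite -qE -(K_order_z p_prime K) expg_order repr_mx1.
    by move/matrixP/(_ (Ordinal d_gt0) (Ordinal d_gt0)); rewrite !mxE eqxx.
  have [m m_prim m_dvd] := prim_order_exists (ltn0Sn q') lzq.
  suff -> : q'.+1 = m by [].
  by apply/eqP; rewrite eqn_dvd m_dvd zX // prim_expr_order.
have [a a_spark] := gabor_full_spark (twist_prim lz_prim).
have [[eta0 eta0_neq0 p0E] _] := p0_min tau d_gt0.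
have G_card := K_card p_prime nG0G K; rewrite qE in G_card.
have x_free := K_transversal p_prime nG0G K; rewrite qE in x_free.
rewrite qE in xq.
have [eta etaE] := exists_transversal_vector T_range sG0G Gx x_free
  (fun i => Num.conj (a i)) eta0.
(* If eta were 0, the window a would vanish and all q^2 pairs would be zeros of its transform,
   against the spark property. *)
have eta_neq0 : eta != 0.
  apply/eqP => eta0E.
  have a0 i : (i < q'.+1)%N -> a i = 0.
    move=> iq; have := etaE i 1%g iq (group1 _).
    rewrite eta0E linear0 ffunE invg1.
    rewrite repr_mx1 mul1mx => /esym/eqP.
    rewrite scaler_eq0 (negPf eta0_neq0) orbF.
    by rewrite conjC_eq0 => /eqP.
  have := a_spark (fun=> 1) (ex_intro _ ord0 (oner_neq0 _)).
  rewrite (_ : gabor_zeros _ _ _ = finset.setT).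
    by rewrite cardsT card_prod card_ord ltnNge leq_pmulr.
  apply/setP => km; rewrite !inE big1 ?eqxx // => j _.
  by rewrite a0 ?mulr0 ?mul0r // ltn_pmod.
have [_ p0_le] := p0_min pi n_gt0.
apply: le_trans (p0_le _ eta_neq0) _.
have [[f f_neq0 ->] _] := p0_at_max pi n_gt0 eta.
have ly_neq0 := scalar_neq0 _ _ Hy tau_y.
have [f0 f0_neq0] := sum_voice_zeros T_range T_isom T_equivar sG0G Gx nG0G
  G_card x_free xq tau_unitary Hy Hz tau_y tau_z ly_neq0 (K_conj_y K) a_spark
  etaE f_neq0.
have [_ /(_ f0 f0_neq0)] := p0_at_max tau d_gt0 eta0.
rewrite -p0E !sum_voice_zeros_card.
rewrite (mulnC 2) exprM -(natrX _ p r) qE G_card natrM.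
move: (#|voice_supp tau _ _|%:R : R) (#|voice_supp pi _ _|%:R : R).
move: (p0 tau) => P s S.
have : 0 < q'.+1%:R :> R by rewrite ltr0n.
have : 0 < #|G0|%:R :> R by rewrite ltr0n cardG_gt0.
move: (q'.+1%:R : R) (#|G0|%:R : R) => q N N0 q0 tau_le zeros_le.
have {}tau_le : N - s <= P * N.
  by rewrite -ler_pdivrMr // mulrBl divff ?gt_eqF.
have -> : 1 - S / (q * N) = (q * (q * N - S)) / (q ^+ 2 * N).
  by field; rewrite !gt_eqF.
have -> : P + (q - 1) / q ^+ 2 =
          (q ^+ 2 * (P * N) + (q - 1) * N) / (q ^+ 2 * N).
  by field; rewrite !gt_eqF.
rewrite ler_pM2r ?invr_gt0 ?mulr_gt0 ?exprn_gt0 //.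
by apply: le_trans zeros_le _; rewrite lerD2r ler_pM2l ?exprn_gt0.
Qed.
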